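(* Let $k$ be a field of characteristic $2$, let $\Delta$ be a pseudo-manifold of dimension $n-1$ with vertices $v_1,\ldots,v_N$, and let $K=k(a_{i,j})_{1\le i\le n,\,1\le j\le N}$. Let $W_\Delta:K[x_1,\ldots,x_N]_n\to K$ be the mixed volume of $\Delta$. Then for any vectors $I,J\in\{1,\ldots,N\}^n$, \[ \partial_I W_\Delta(x_J)=\begin{cases}\big(W_\Delta(\sqrt{x_Ix_J})\big)^2 & \text{if } \sqrt{x_Ix_J} \text{ exists},\\ 0&\text{otherwise.}\end{cases} \]
   Context: A pseudo-manifold of dimension $n-1$ is a (finite, abstract) pure simplicial complex $\Delta$ of dimension $n-1$ such that every $(n-2)$-simplex lies in exactly two $(n-1)$-simplices and the geometric realization of $\Delta$ remains connected after removing its $(n-3)$-skeleton. Mixed volume (characteristic $2$). For a maximal simplex $\sigma=\{v_{j_1},\ldots,v_{j_n}\}$ put $\det\sigma=\det(a_{p,j_q})_{1\le p,q\le n}$ (in characteristic $2$ the ordering of the vertices does not matter). Let $\phi_\sigma:K[t_1,\ldots,t_n]\to K[x_{j_1},\ldots,x_{j_n}]$ be the isomorphism $t_p\mapsto\sum_qa_{p,j_q}x_{j_q}$. For $f\in K[x_1,\ldots,x_N]$ let $f_\sigma\in K[t_1,\ldots,t_n]$ be obtained by setting $x_j=0$ for all $v_j\notin\sigma$ and applying $\phi_\sigma^{-1}$; let $\chi_\sigma=(\det\sigma)\,\phi_\sigma^{-1}(x_{j_1}\cdots x_{j_n})$. For $f$ homogeneous of degree $n$ the sum $W_\Delta(f)=\sum_\sigma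 f_\sigma/\chi_\sigma$ over all maximal simplices $\sigma$ is an element of $K$; this defines the linear function $W_\Delta:K[x_1,\ldots,x_N]_n\to K$, where the subscript $n$ denotes the homogeneous part of degree $n$. Notation. For $I=(i_1,\ldots,i_n)$, $\partial_I=\partial_{a_{1,i_1}}\partial_{a_{2,i_2}}\cdots\partial_{a_{n,i_n}}$ is the composition of the ($k$-linear) partial derivatives on $K$ with respect to the variables $a_{1,i_1},\ldots,a_{n,i_n}$. For a vector $J=(j_1,\ldots,j_s)$, $x_J=x_{j_1}\cdots x_{j_s}$; entries may repeat. $\sqrt{x_Ix_J}$ denotes the monomial whose square is $x_Ix_J$, if such a monomial exists. *)

(* Defs.v *)
From HB Require Import structures.
From mathcomp Require Import all_boot all_order all_algebra fraction.
From mathcomp Require boolp classical_sets reals topology.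

Set Implicit Arguments.
Unset Strict Implicit.
Unset Printing Implicit Defensive.

Import GRing.Theory Num.Theory.

(* The vertices v_1, ..., v_N are the elements of 'I_N, and an abstract        *)
(* simplicial complex is the set of its faces, the empty face included.        *)
Section Complexes.
Variable N : nat.
Implicit Types (D : {set {set 'I_N}}) (F G : {set 'I_N}).

Definition simplicial_complex D : Prop :=
  [/\ set0 \in D,
      forall j : 'I_N, [set j] \in D
    & forall F G, G \in D -> F \subset G -> F \in D].

Definition facets D : {set {set 'I_N}} :=
  [set F | maxset (fun G => G \in D) F].

(* skeleton D m consists of the faces with at most m vertices: it is the       *)
(* (m - 1)-skeleton of D.                                                      *)
Definition skeleton D (m : nat) : {set {set 'I_N}} := [set F in D | #|F| <= m].

End Complexes.

(* The topological libraries are imported in this module only: their notations *)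
(* are incompatible with those of mpoly.                                       *)
Module Realization.
Import boolp classical_sets reals topology.
Import numFieldTopology.Exports.
Local Open Scope classical_set_scope.
Local Open Scope ring_scope.

(* Barycentric coordinates: the vertex v_j is the j-th basis vector of R^N.    *)
Definition realization (R : realType) (N : nat) (D : {set {set 'I_N}}) :
    set 'rV[R]_N :=
  [set x | [/\ forall j, 0 <= x ord0 j, \sum_j x ord0 j = 1
             & finset (fun j => x ord0 j != 0) \in D]].

Definition connected_off (R : realType) (N : nat) (D E : {set {set 'I_N}}) :
    Prop :=
  connected (@realization R N D `\` @realization R N E).

End Realization.

From mathcomp Require Import generic_quotient reals mpoly ring.

Local Open Scope ring_scope.

Notation "x %:F" := (@FracField.tofrac _ x) : ring_scope.

(* A simplex of dimension d has d + 1 vertices. For n = 1 the truncated        *)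
(* difference n - 2 is harmless: skeleton D 0 = [set set0], whose realization  *)
(* is empty, as is the (-2)-skeleton.                                          *)
Definition pseudo_manifold (R : realType) (n N : nat)
    (D : {set {set 'I_N}}) : Prop :=
  [/\ simplicial_complex D,
      forall F, F \in facets D -> #|F| = n,
      forall F, F \in D -> #|F|.+1 = n ->
        #|[set G in D | (#|G| == n) && (F \subset G)]| = 2%N
    & Realization.connected_off R D (skeleton D (n - 2))].

Lemma frac_repr (A : idomainType) (x : {fraction A}) :
  x = (\n_(repr x))%:F / (\d_(repr x))%:F.
Proof.
have dx := denom_ratioP (repr x).
rewrite -[LHS]reprK /GRing.inv /= /GRing.mul /= !piE.
apply/eqmodP; rewrite /= FracField.equivfE /FracField.invf /FracField.mulf.
by rewrite !numden_Ratio ?mul1r ?mulr1 ?oner_neq0 // mulrC.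
Qed.

Lemma eq_frac (A : idomainType) (p q p' q' : A) : q != 0 -> q' != 0 ->
  (p%:F / q%:F == p'%:F / q'%:F) = (p * q' == p' * q).
Proof. by move=> q0 q'0; rewrite eqr_div ?tofrac_eq0 // -!tofracM tofrac_eq. Qed.

(* The partial derivative with respect to the i-th variable, extended to the   *)
(* field of rational functions by the quotient rule (see frac_mderivE).        *)
Definition frac_mderiv (k : fieldType) (m : nat) (i : 'I_m)
    (x : {fraction {mpoly k[m]}}) : {fraction {mpoly k[m]}} :=
  let p := \n_(repr x) in let q := \d_(repr x) in
  (p^`M(i) * q - p * q^`M(i))%:F / (q ^+ 2)%:F.

Lemma frac_mderivE (k : fieldType) (m : nat) (i : 'I_m) (p q : {mpoly k[m]}) :
  q != 0 ->
  frac_mderiv i (p%:F / q%:F) = (p^`M(i) * q - p * q^`M(i))%:F / (q ^+ 2)%:F.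
Proof.
move=> q0; rewrite /frac_mderiv.
set P := \n_ _; set Q := \d_ _.
have Q0 : Q != 0 by exact: denom_ratioP.
have e : p * Q = P * q by apply/eqP; rewrite -eq_frac // -frac_repr.
apply/eqP; rewrite eq_frac ?expf_neq0 //.
have := congr1 (mderiv i) e; rewrite !mderivM => e'; clearbody P Q.
move: (P^`M(i)) (Q^`M(i)) (p^`M(i)) (q^`M(i)) e' => P' Q' p' q' e'.
rewrite -subr_eq0; apply/eqP.
transitivity ((p * Q - P * q) * (Q * q' + q * Q') -
  Q * q * (p' * Q + p * Q' - (P' * q + P * q'))); first by ring.
by rewrite e e' !subrr mul0r mulr0 subr0.
Qed.

Definition x_ (A : nzRingType) (N s : nat) (J : s.-tuple 'I_N) : {mpoly A[N]} :=
  \prod_(q < s) 'X_(tnth J q).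

Section MixedVolume.
Variables (k : fieldType) (n N : nat).

Local Notation K := {fraction {mpoly k[n * N]}}.

Definition a_ (i : 'I_n) (j : 'I_N) : K := ('X_(mxvec_index i j))%:F.

Definition partial_a (i : 'I_n) (j : 'I_N) : K -> K :=
  frac_mderiv (mxvec_index i j).

Definition partial_ (I : n.-tuple 'I_N) (c : K) : K :=
  foldr (fun p => partial_a p (tnth I p)) c (enum 'I_n).

(* A simplex with n vertices is given as the tuple s of its vertices, in       *)
(* increasing order; K[x_{j_1}, ..., x_{j_n}] is {mpoly K[n]}, its q-th        *)
(* variable standing for x_{j_q} where j_q = tnth s q.                         *)
Section Simplex.
Variable s : n.-tuple 'I_N.

Definition amx : 'M[K]_n := \matrix_(p, q) a_ p (tnth s q).

Definition phi (g : {mpoly K[n]}) : {mpoly K[n]} :=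
  g \mPo [tuple \sum_q amx p q *: 'X_q | p < n].

(* The inverse of phi: see phiK and phi_invK.                                  *)
Definition phi_inv (g : {mpoly K[n]}) : {mpoly K[n]} :=
  g \mPo [tuple \sum_p invmx amx q p *: 'X_p | q < n].

(* Sets x_j = 0 for every v_j outside the simplex.                             *)
Definition restrict (f : {mpoly K[N]}) : {mpoly K[n]} :=
  f \mPo [tuple \sum_(q | tnth s q == j) 'X_q | j < N].

Definition f_at (f : {mpoly K[N]}) : {mpoly K[n]} := phi_inv (restrict f).

Definition chi : {mpoly K[n]} := \det amx *: phi_inv (\prod_q 'X_q).

End Simplex.

Definition ordered_facets (D : {set {set 'I_N}}) : {set n.-tuple 'I_N} :=
  [set s : n.-tuple 'I_N |
    sorted ltn [seq val j | j <- s] & [set j in s] \in facets D].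

Definition mixed_volume_sum (D : {set {set 'I_N}}) (f : {mpoly K[N]}) :
    {fraction {mpoly K[n]}} :=
  \sum_(s in ordered_facets D) (f_at s f)%:F / (chi s)%:F.

(* The element of K equal to the sum, for D a pseudo-manifold and f            *)
(* homogeneous of degree n; 0 by convention when the sum is not in K.          *)
Definition mixed_volume (D : {set {set 'I_N}}) (f : {mpoly K[N]}) : K :=
  classical_sets.xget 0 (fun c : K => mixed_volume_sum D f = (c%:MP)%:F).

End MixedVolume.

Lemma det_amx_neq0 (k : fieldType) n N (s : n.-tuple 'I_N) : uniq s -> \det (amx k s) != 0.
Proof.
move=> us.
pose B := \matrix_(p, q) 'X_(mxvec_index p (tnth s q)) : 'M[{mpoly k[n * N]}]_n.
have -> : amx k s = map_mx (@FracField.tofrac _) B.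
  by apply/matrixP=> p q; rewrite !mxE.
rewrite det_map_mx tofrac_eq0; apply: contraTneq isT => B0.
pose v := mxvec (\matrix_(p < n, j < N) (tnth s p == j)%:R : 'M[k]_(n, N)) 0.
have: \det (map_mx (meval v) B) = 0 by rewrite det_map_mx /= B0 raddf0.
suff -> : map_mx (meval v) B = 1%:M by rewrite det1 => /eqP; rewrite oner_eq0.
apply/matrixP=> p q; rewrite !mxE mevalXU /v mxvecE mxE.
by rewrite (inj_eq (tuple_uniqP _ us)).
Qed.

Lemma amx_unit (k : fieldType) n N (s : n.-tuple 'I_N) : uniq s -> amx k s \in unitmx.
Proof. by move=> us; rewrite unitmxE unitfE det_amx_neq0. Qed.

Lemma comp_mpolyA (A : comNzRingType) (l m n : nat) (g : {mpoly A[l]})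
    (u : l.-tuple {mpoly A[m]}) (v : m.-tuple {mpoly A[n]}) :
  (g \mPo u) \mPo v = g \mPo [tuple tnth u i \mPo v | i < l].
Proof.
rewrite (comp_mpolyE g u) (comp_mpolyE g [tuple _ | _ < _]) raddf_sum /=.
apply: eq_bigr => m0 _; rewrite linearZ rmorph_prod /=; congr (_ *: _).
by apply: eq_bigr => i _; rewrite tnth_mktuple rmorphXn.
Qed.

Lemma linear_substK (A : comNzRingType) (n : nat) (B C : 'M[A]_n) (g : {mpoly A[n]}) :
  B *m C = 1%:M ->
  (g \mPo [tuple \sum_j B i j *: 'X_j | i < n]) \mPo
    [tuple \sum_j C i j *: 'X_j | i < n] = g.
Proof.
move=> BC; rewrite comp_mpolyA -[RHS]comp_mpoly_id; congr (_ \mPo _).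
apply: eq_from_tnth => i; rewrite !tnth_mktuple linear_sum /=.
under eq_bigr => j _ do rewrite linearZ /= comp_mpolyXU -tnth_nth tnth_mktuple scaler_sumr.
rewrite exchange_big /=.
transitivity (\sum_l (B *m C) i l *: 'X_l : {mpoly A[n]}).
  apply: eq_bigr => l _; rewrite mxE scaler_suml.
  by apply: eq_bigr => j _; rewrite scalerA.
rewrite BC (bigD1 i) //= mxE eqxx scale1r big1 ?addr0 // => l li.
by rewrite mxE eq_sym (negPf li) scale0r.
Qed.

Lemma phiK (k : fieldType) n N (s : n.-tuple 'I_N) : uniq s ->
  cancel (@phi k n N s) (phi_inv s).
Proof. by move=> us g; apply: linear_substK; rewrite mulmxV ?amx_unit. Qed.

Lemma phi_invK (k : fieldType) n N (s : n.-tuple 'I_N) : uniq s ->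
  cancel (@phi_inv k n N s) (phi s).
Proof. by move=> us g; apply: linear_substK; rewrite mulVmx ?amx_unit. Qed.

Lemma ordered_facets_uniq n N (D : {set {set 'I_N}}) (s : n.-tuple 'I_N) :
  s \in ordered_facets n D -> uniq s.
Proof.
rewrite inE => /andP[/(sorted_uniq ltn_trans ltnn)].
by rewrite map_inj_uniq //; apply: val_inj.
Qed.

Lemma ordered_facetsP n N (D : {set {set 'I_N}}) :
  (forall F, F \in facets D -> #|F| = n) ->
  {in ordered_facets n D &, injective (fun s : n.-tuple 'I_N => [set j in s])} /\
  [set [set j in s] | s : n.-tuple 'I_N in ordered_facets n D] = facets D.
Proof.
move=> pureD; split=> [s t|].
  rewrite !inE => /andP[ss _] /andP[st _] /setP e; apply/val_inj/(inj_map val_inj).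
  apply: (irr_sorted_eq ltn_trans ltnn) => // x.
  by apply/mapP/mapP => -[j jin ->]; exists j => //; move: (e j); rewrite !inE jin.
apply/setP => F; apply/imsetP/idP => [[s]|FD]; first by rewrite inE => /andP[_ ? ->].
have sF : size (enum F) == n by rewrite -cardE pureD.
have FE : [set j in Tuple sF] = F by apply/setP => j; rewrite inE mem_enum.
exists (Tuple sF) => //; rewrite inE FE FD andbT.
rewrite sorted_map; apply: sorted_filter; first by move=> x y z; apply: ltn_trans.
by have := iota_ltn_sorted 0 N; rewrite -val_enum_ord sorted_map enumT.
Qed.

Lemma mixed_volumeE (k : fieldType) n N (D : {set {set 'I_N}}) f c :
  @mixed_volume_sum k n N D f = (c%:MP)%:F -> mixed_volume D f = c.
Proof.
move=> e; apply: classical_sets.xget_unique => // d.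
by rewrite e => /eqP; rewrite tofrac_eq => /eqP/(congr1 (mcoeff 0%MM)); rewrite !mcoeffC eqxx !mulr1.
Qed.

(* Main.v *)
Require Import Defs.
From HB Require Import structures.
From mathcomp Require Import all_boot all_order perm all_algebra fraction.
From mathcomp Require Import reals.
From mathcomp Require Import mpoly ring.

Set Implicit Arguments.
Unset Strict Implicit.
Unset Printing Implicit Defensive.

Import GRing.Theory.

Local Open Scope ring_scope.

(** Fix a facet s, put A = (a_{p,s_q}), and for a vector u let x = A^-1 u. The
summand of W(f) at s, with t specialized to u, is f(x) / (det A . prod_q x_q).
The theorem follows from two facts about these fractions.

The sum does not depend on u ([sum_facet_terms]). For u = t and u = e with
coordinates x and y, decompose f(x - z y) / (z . prod_q (x_q - z y_q)) into
partial fractions in z. The residues at 0 and at infinity are the summands for t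
and for e. The residue at z = x_q / y_q depends only on the ridge s \ {s_q} and
not on s, because t - z e is then the only vector of the line through t in the
direction e that is spanned by the columns of the ridge. Every ridge lies in exactly two facets, so these
residues cancel in characteristic 2. Specializing to the first basis vector e,
whose coordinates are the entries of the first column of A^-1 and are nonzero,
writes W(f) as a sum of explicit elements of K ([mixed_volume_monomial]).

Each summand satisfies the identity. Let b_p be the p-th column of A^-1, let y
be the coordinate vector of e, and let D_p be the derivation with respect to
a_{p,i_p}. In characteristic 2, D_p y_j = y_{i_p} b_{p,j},
D_p b_{q,j} = b_{q,i_p} b_{p,j} and D_p det A = det A . b_{p,i_p}. Hence
D_p (det A . G(y)) = det A . (E_p G)(y), where E_p applies D_p to the
coefficients of G and adds the derivative of X_{i_p} G in the direction b_p.
The operator E_p commutes with all directional derivatives along the b_q, which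
gives ([iterated_flow]), for every monomial G,

  D_1 ... D_n (det A . G(y)) = det A . (d_{b_1} ... d_{b_n} (x_I G)) (y).

Squares are constants for all these derivations, so this applies to the summand
x_J(y) / (det A . prod_q y_q), which is det A . G(y) with G = x_J . prod_q x_{s_q}
up to a square. If x_I x_J is the square of x_h, it comes out of the derivatives
and d_{b_1} ... d_{b_n} (prod_q x_{s_q}) is the permanent of A^-1, that is
1 / det A. Otherwise either x_I x_J has a variable outside s, where y and all
the b_p vanish, or the squarefree part of x_I G has fewer than n variables and
its n-th derivatives vanish. Finally squaring is additive, so the identities for
the facets add up. *)

(** * Directional derivatives of polynomials *)

Lemma mderiv_var (R : nzRingType) (N : nat) (i j : 'I_N) :
  ('X_j : {mpoly R[N]})^`M(i) = (i == j)%:R.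
Proof.
rewrite mderivX mnm1E eq_sym; case: eqP => [->|_]; last by rewrite scale0r.
by rewrite scale1r -{1}[U_(j)%MM]add0m addmK mpolyX0.
Qed.

Section DirectionalDerivative.
Variables (F : fieldType) (N : nat).
Implicit Types (b : 'I_N -> F) (G H : {mpoly F[N]}).

Definition dirD b G : {mpoly F[N]} := \sum_j b j *: G^`M(j).

Lemma dirD_is_linear b : linear (dirD b).
Proof.
move=> c G H; rewrite /dirD scaler_sumr -big_split /=; apply: eq_bigr => j _.
by rewrite linearP scalerDr !scalerA mulrC.
Qed.

HB.instance Definition _ b :=
  GRing.isLinear.Build F {mpoly F[N]} {mpoly F[N]} _ (dirD b) (dirD_is_linear b).

Lemma dirDM b G H : dirD b (G * H) = dirD b G * H + G * dirD b H.
Proof.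
rewrite /dirD mulr_suml mulr_sumr -big_split /=; apply: eq_bigr => j _.
by rewrite mderivM scalerDr scalerAl scalerAr.
Qed.

Lemma mderiv_dirD b i G : (dirD b G)^`M(i) = dirD b G^`M(i).
Proof.
rewrite /dirD (raddf_sum (mderiv i)); apply: eq_bigr => j _ /=.
by rewrite mderivZ mderiv_comm.
Qed.

Lemma dirD_comm b b' G : dirD b (dirD b' G) = dirD b' (dirD b G).
Proof.
rewrite [dirD b' G]/dirD (raddf_sum (dirD b)); apply: eq_bigr => j _ /=.
by rewrite linearZ mderiv_dirD.
Qed.

Lemma dirDX b j : dirD b 'X_j = (b j)%:MP.
Proof.
rewrite /dirD (bigD1 j) //= big1 => [|i ij]; last first.
  by rewrite mderiv_var (negPf ij) scaler0.
by rewrite addr0 mderiv_var eqxx -mul_mpolyC mulr1.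
Qed.

Lemma meval_dirD b G y : (dirD b G).@[y] = \sum_j G^`M(j).@[y] * b j.
Proof.
rewrite /dirD (raddf_sum (meval y)); apply: eq_bigr => j _ /=.
by rewrite mevalZ mulrC.
Qed.

Definition dirDs (I : Type) (b : I -> 'I_N -> F) (ps : seq I) G : {mpoly F[N]} :=
  foldr (fun p => dirD (b p)) G ps.

End DirectionalDerivative.

(** * Derivations of the coefficient field and evaluation *)

Section Derivation.
Variables (F : fieldType) (N : nat) (D : {additive F -> F}).
Hypothesis DM : forall x y, D (x * y) = D x * y + x * D y.
Implicit Types (y : 'I_N -> F) (G H : {mpoly F[N]}).

Lemma derivation1 : D 1 = 0.
Proof. by apply: (@addrI _ (D 1)); rewrite addr0 -{3}[1]mulr1 DM mulr1 mul1r. Qed.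

Lemma derivation_mapZ c G :
  map_mpoly D (c *: G) = D c *: G + c *: map_mpoly D G.
Proof.
by apply/mpolyP => m; rewrite mcoeffD !mcoeffZ !mcoeff_map_mpoly mcoeffZ DM.
Qed.

Lemma derivation_mapX m : map_mpoly D ('X_[m] : {mpoly F[N]}) = 0.
Proof.
apply/mpolyP => m'; rewrite mcoeff_map_mpoly mcoeffX mcoeff0.
by case: eqP; rewrite ?derivation1 ?raddf0.
Qed.

Lemma derivation_map_mderiv j G :
  map_mpoly D G^`M(j) = (map_mpoly D G)^`M(j).
Proof.
apply/mpolyP => m.
by rewrite mcoeff_map_mpoly !mcoeff_deriv mcoeff_map_mpoly raddfMn.
Qed.

Lemma derivation_map_dirD b G :
  map_mpoly D (dirD b G) = dirD (D \o b) G + dirD b (map_mpoly D G).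
Proof.
rewrite /dirD raddf_sum -big_split; apply: eq_bigr => j _ /=.
by rewrite derivation_mapZ derivation_map_mderiv.
Qed.

Lemma derivation_mevalX y m :
  D ('X_[m] : {mpoly F[N]}).@[y] = \sum_j ('X_[m] : {mpoly F[N]})^`M(j).@[y] * D (y j).
Proof.
pose chain G := D G.@[y] = \sum_j G^`M(j).@[y] * D (y j).
have chain1 : chain 1.
  rewrite /chain meval1 derivation1 big1 // => j _.
  by rewrite -mpolyC1 mderivC meval0 mul0r.
have chainM G H : chain G -> chain H -> chain (G * H).
  rewrite /chain mevalM DM => -> ->.
  rewrite mulr_suml mulr_sumr -big_split; apply: eq_bigr => j _ /=.
  by rewrite mderivM mevalD !mevalM; ring.
rewrite -/(chain _) mpolyXE_id; apply: (big_ind chain) => // i _.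
elim: (m i) => [|e IH]; rewrite ?expr0 // exprS; apply: chainM => //.
rewrite /chain mevalXU (bigD1 i) //= big1 => [|j ji].
  by rewrite addr0 mderiv_var eqxx meval1 mul1r.
by rewrite mderiv_var (negPf ji) meval0 mul0r.
Qed.

(** Chain rule: the first summand differentiates the coefficients, the others the
point of evaluation. *)
Lemma derivation_meval y G :
  D G.@[y] = (map_mpoly D G).@[y] + \sum_j G^`M(j).@[y] * D (y j).
Proof.
elim/mpolyind: G => [|c m G _ _ IH].
  rewrite !(raddf0, meval0) add0r big1 // => j _.
  by rewrite mderiv0 meval0 mul0r.
rewrite mevalD raddfD IH mevalZ DM derivation_mevalX raddfD.
rewrite /= derivation_mapZ derivation_mapX scaler0 addr0.
rewrite mevalD mevalZ.
under [in RHS]eq_bigr do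
  rewrite linearD linearZ /= mevalD mevalZ mulrDl -mulrA.
by rewrite big_split -mulr_sumr /=; ring.
Qed.

(** These hypotheses are what d/da_{p0,i0} does to a column y of A^-1, to all the
columns b of A^-1 and to d = det A, when the signs are dropped. *)
Variables (n : nat) (y : 'I_N -> F) (b : 'I_n -> 'I_N -> F) (d : F).
Variables (p0 : 'I_n) (i0 : 'I_N).
Hypothesis Dy : forall j, D (y j) = y i0 * b p0 j.
Hypothesis Db : forall p j, D (b p j) = b p i0 * b p0 j.
Hypothesis Dd : D d = d * b p0 i0.

(** By [flow_meval], E is the derivation D transported to polynomials through
G |-> d . G(y). *)
Let E G := map_mpoly D G + dirD (b p0) ('X_i0 * G).

Lemma flow_meval G : D (d * G.@[y]) = d * (E G).@[y].
Proof.
rewrite DM Dd derivation_meval /E mevalD dirDM dirDX mevalD !mevalM mevalC mevalXU.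
rewrite meval_dirD; under eq_bigr do rewrite Dy mulrCA.
by rewrite -mulr_sumr; ring.
Qed.

(** Differentiating the coefficients of [dirD (b p)] produces b_{p,i0} d_{b_p0}, and
commuting d_{b_p} with the multiplication by X_i0 produces the same term on the
other side. *)
Lemma flow_dirD p G : E (dirD (b p) G) = dirD (b p) (E G).
Proof.
have Dbp : dirD (D \o b p) G = b p i0 *: dirD (b p0) G.
  by rewrite /dirD scaler_sumr; apply: eq_bigr => j _ /=; rewrite Db scalerA.
rewrite /E derivation_map_dirD Dbp (raddfD (dirD (b p))) /=.
rewrite [dirD (b p) (dirD _ _)]dirD_comm [dirD (b p) (_ * _)]dirDM.
rewrite dirDX mul_mpolyC dirD_is_linear.
by rewrite -addrA addrCA.
Qed.

(** Moving E inside lets it act on a monomial, whose coefficients D kills. *)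
Lemma flow_dirDs ps m :
  E (dirDs b ps 'X_[m]) =
  dirD (b p0) (dirDs b ps ('X_i0 * 'X_[m])).
Proof.
elim: ps => [|p ps IH] /=; first by rewrite /E derivation_mapX add0r.
by rewrite flow_dirD IH dirD_comm.
Qed.

End Derivation.

(** All the derivations act on d . G(y) through directional derivatives of one
monomial; this replaces derivatives of rational functions of the matrix by
derivatives of a polynomial with constant coefficients. *)
Lemma iterated_flow (F : fieldType) (n N : nat) (D : 'I_n -> {additive F -> F})
    (i : 'I_n -> 'I_N) (y : 'I_N -> F) (b : 'I_n -> 'I_N -> F) (d : F)
    (DM : forall p, forall x y, D p (x * y) = D p x * y + x * D p y)
    (Dy : forall p j, D p (y j) = y (i p) * b p j)
    (Db : forall p q j, D p (b q j) = b q (i p) * b p j)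
    (Dd : forall p, D p d = d * b p (i p)) ps m :
  foldr (fun p => D p) (d * ('X_[m] : {mpoly F[N]}).@[y]) ps =
  d * (dirDs b ps ('X_[\sum_(p <- ps) U_(i p) + m] : {mpoly F[N]})).@[y].
Proof.
elim: ps => [|p ps IH] /=; first by rewrite big_nil add0m.
rewrite IH (flow_meval (DM p) (Dy p) (Dd p)) (flow_dirDs (DM p) (Db p)).
by rewrite big_cons -addmA [in RHS]mpolyXD.
Qed.

(** * Iterated directional derivatives of monomials *)

Section IteratedDerivative.
Variables (F : fieldType) (N : nat).
Implicit Types (G H : {mpoly F[N]}).

Lemma dirDs_is_linear (I : Type) (b : I -> 'I_N -> F) ps :
  linear (dirDs b ps).
Proof. by move=> c G H; rewrite /dirDs; elim: ps => //= p ps ->; rewrite dirD_is_linear. Qed.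

HB.instance Definition _ (I : Type) (b : I -> 'I_N -> F) ps :=
  GRing.isLinear.Build F {mpoly F[N]} {mpoly F[N]} _ (dirDs b ps)
    (dirDs_is_linear b ps).

Lemma dirDs_comm (I : Type) (b : I -> 'I_N -> F) b' ps G :
  dirD b' (dirDs b ps G) =
  dirDs b ps (dirD b' G).
Proof. by rewrite /dirDs; elim: ps => //= p ps <-; rewrite dirD_comm. Qed.

Lemma dirDs_mul (I : Type) (b : I -> 'I_N -> F) ps G H :
  (forall p, dirD (b p) G = 0) ->
  dirDs b ps (G * H) =
  G * dirDs b ps H.
Proof. by move=> G0; rewrite /dirDs; elim: ps => //= p ps ->; rewrite dirDM G0 mul0r add0r. Qed.

Lemma dirD_sqr b G : 2%N \in [pchar F] -> dirD b (G ^+ 2) = 0.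
Proof.
move=> ch; rewrite expr2 dirDM mulrC -mulr2n -scaler_nat.
by rewrite (pcharf0 ch) scale0r.
Qed.

Lemma dirD_prod_var b m (c : 'I_m.+1 -> 'I_N) :
  dirD b (\prod_q 'X_(c q)) =
  \sum_q b (c q) *: \prod_(r < m) ('X_(c (lift q r)) : {mpoly F[N]}).
Proof.
elim: m c => [|m IH] c.
  by rewrite !big_ord_recl !big_ord0 mulr1 addr0 dirDX -mul_mpolyC mulr1.
rewrite big_ord_recl dirDM IH dirDX [in RHS]big_ord_recl mul_mpolyC; congr (_ + _).
rewrite mulr_sumr; apply: eq_bigr => q _; rewrite -scalerAr; congr (_ *: _).
rewrite big_ord_recl; congr (_ * _).
  by rewrite (_ : @lift m.+2 (lift ord0 q) ord0 = ord0) //; apply: val_inj.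
apply: eq_bigr => r _.
rewrite (_ : @lift m.+2 (lift ord0 q) (lift ord0 r) = lift ord0 (lift q r)) //.
by apply: val_inj; rewrite /= /bump /= ltnS addnCA.
Qed.

Lemma dirDs_prod_small (I : Type) (b : I -> 'I_N -> F) ps m (c : 'I_m -> 'I_N) :
  (m < size ps)%N ->
  dirDs b ps (\prod_q ('X_(c q) : {mpoly F[N]})) = 0.
Proof.
elim: ps m c => // p ps IH [|m] c mps; rewrite [LHS]dirDs_comm.
  by rewrite big_ord0 -mpolyC1 /dirD big1 ?linear0 // => j _; rewrite mderivC scaler0.
rewrite dirD_prod_var linear_sum big1 // => q _.
by rewrite linearZ /= IH ?scaler0.
Qed.

(** In general the left-hand side is the permanent of B; it satisfies the Laplace
expansion along the first row, without signs. *)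
Lemma dirDs_prod n (B : 'M[F]_n) (c : 'I_n -> 'I_N) (b : 'I_n -> 'I_N -> F) :
  2%N \in [pchar F] ->
  (forall p q, b p (c q) = B p q) ->
  dirDs b (enum 'I_n) (\prod_q ('X_(c q) : {mpoly F[N]})) =
  (\det B)%:MP.
Proof.
move=> ch; elim: n B c b => [|n IH] B c b bB.
  have -> : enum 'I_0 = [::] by apply: size0nil; rewrite size_enum_ord.
  by rewrite det_mx00 big_ord0.
rewrite enum_ordSl [LHS]dirDs_comm dirD_prod_var linear_sum.
rewrite (expand_det_row _ ord0) raddf_sum; apply: eq_bigr => q _ /=.
rewrite linearZ /= /dirDs foldr_map -mul_mpolyC bB mpolyCM; congr (_ * _).
rewrite /cofactor oppr_pchar2 // expr1n mul1r; apply: IH => p r.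
by rewrite bB !mxE.
Qed.

End IteratedDerivative.

(** * Partial derivatives of rational functions *)

Lemma tofrac_subf (A : idomainType) (p q r s : A) : q != 0 -> s != 0 ->
  p%:F / q%:F - r%:F / s%:F = (p * s - r * q)%:F / (q * s)%:F.
Proof.
move=> q0 s0; rewrite -mulNr addf_div ?tofrac_eq0 // mulNr.
by rewrite -!tofracM -tofracB.
Qed.

Section FractionDerivation.
Variables (k : fieldType) (m : nat) (i : 'I_m).
Local Notation A := {mpoly k[m]}.
Local Notation K := {fraction A}.
Implicit Types x y : K.

Lemma frac_mderiv_tofrac (p : A) : frac_mderiv i p%:F = (p^`M(i))%:F.
Proof.
rewrite -[p%:F]divr1 -tofrac1 frac_mderivE ?oner_eq0 //.
by rewrite -mpolyC1 mderivC mulr0 subr0 mpolyC1 mulr1 expr1n divr1.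
Qed.

Lemma frac_mderiv_is_additive : zmod_morphism (@frac_mderiv k m i).
Proof.
move=> x y; rewrite [x]frac_repr [y]frac_repr.
have := denom_ratioP (repr x); have := denom_ratioP (repr y).
move: \n_(repr x) \d_(repr x) \n_(repr y) \d_(repr y) => p q r s s0 q0.
rewrite tofrac_subf // !frac_mderivE ?mulf_neq0 // tofrac_subf ?expf_neq0 //.
apply/eqP; rewrite eq_frac ?mulf_neq0 ?expf_neq0 ?mulf_neq0 //; apply/eqP.
rewrite mderivB !mderivM.
ring.
Qed.

Lemma frac_mderivM x y :
  frac_mderiv i (x * y) = frac_mderiv i x * y + x * frac_mderiv i y.
Proof.
rewrite [x]frac_repr [y]frac_repr.
have := denom_ratioP (repr x); have := denom_ratioP (repr y).
move: \n_(repr x) \d_(repr x) \n_(repr y) \d_(repr y) => p q r s s0 q0.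
rewrite mulf_div -!tofracM !frac_mderivE ?mulf_neq0 //.
rewrite !mulf_div -!tofracM addf_div ?tofrac_eq0 ?mulf_neq0 ?expf_neq0 //.
rewrite -!tofracM -tofracD.
apply/eqP; rewrite eq_frac ?mulf_neq0 ?expf_neq0 ?mulf_neq0 //; apply/eqP.
rewrite !mderivM.
ring.
Qed.

HB.instance Definition _ :=
  GRing.isZmodMorphism.Build K K (@frac_mderiv k m i) frac_mderiv_is_additive.

End FractionDerivation.

HB.instance Definition _ (k : fieldType) n N (p : 'I_n) (j : 'I_N) :=
  GRing.Additive.copy (@partial_a k n N p j) (frac_mderiv (mxvec_index p j)).

Lemma eq_mxvec_index n N (p q : 'I_n) (i j : 'I_N) :
  (mxvec_index p i == mxvec_index q j) = (p == q) && (i == j).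
Proof.
apply/eqP/andP => [/cast_ord_inj/enum_rank_inj [-> ->] //|[/eqP-> /eqP->] //].
Qed.

Lemma partial_a_var (k : fieldType) n N (p q : 'I_n) (i j : 'I_N) :
  partial_a p i (a_ k q j) = ((q == p) && (j == i))%:R.
Proof.
rewrite /partial_a /a_ frac_mderiv_tofrac mderiv_var eq_mxvec_index eq_sym [i == j]eq_sym.
by case: (_ && _); rewrite ?tofrac1 ?tofrac0.
Qed.

Lemma partial_aM (k : fieldType) n N (p : 'I_n) (i : 'I_N) x y :
  @partial_a k n N p i (x * y) = partial_a p i x * y + x * partial_a p i y.
Proof. exact: frac_mderivM. Qed.

(** * Derivatives of an inverse matrix and of a determinant *)

Section DerivationMatrix.
Variables (F : fieldType) (D : {additive F -> F}).
Hypothesis DM : forall x y, D (x * y) = D x * y + x * D y.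

Lemma derivation_sqr x : 2%N \in [pchar F] -> D (x ^+ 2) = 0.
Proof. by move=> ch; rewrite expr2 DM mulrC addrr_pchar2. Qed.

Lemma derivation_mul_sqr x u : 2%N \in [pchar F] -> D (x * u ^+ 2) = D x * u ^+ 2.
Proof. by move=> ch; rewrite DM derivation_sqr // mulr0 addr0. Qed.

Lemma derivation_det0 n (M : 'M[F]_n) : (forall p q, D (M p q) = 0) -> D (\det M) = 0.
Proof.
move=> DM0; rewrite raddf_sum big1 // => s _ /=.
suff Dprod : D (\prod_i M i (s i)) = 0.
  by rewrite mulr_sign; case: ifP; rewrite ?raddfN /= Dprod ?oppr0.
apply: (big_ind (fun x => D x = 0)) => // [|x y Dx Dy]; first exact: derivation1.
by rewrite DM Dx Dy mul0r mulr0 addr0.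
Qed.

Lemma derivation_mulmx m n p (A : 'M[F]_(m, n)) (B : 'M[F]_(n, p)) :
  map_mx D (A *m B) = map_mx D A *m B + A *m map_mx D B.
Proof.
apply/matrixP => i j; rewrite !mxE raddf_sum -big_split /=.
by apply: eq_bigr => l _; rewrite DM !mxE.
Qed.

Variables (n N : nat) (A : 'M[F]_n) (c : 'I_n -> 'I_N) (p0 : 'I_n) (i0 : 'I_N).
Hypothesis ch : 2%N \in [pchar F].
Hypothesis A_unit : A \in unitmx.
Hypothesis DA : forall p q, D (A p q) = ((p == p0) && (c q == i0))%:R.

(** From D(A^-1) = - A^-1 D(A) A^-1, where D(A) is supported in the row p0 and in the
columns q with c q = i0. *)
Lemma derivation_invmx q p :
  D (invmx A q p) = (\sum_(r | c r == i0) invmx A r p) * invmx A q p0.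
Proof.
have DB : map_mx D (invmx A) = invmx A *m map_mx D A *m invmx A.
  have := derivation_mulmx A (invmx A); rewrite mulmxV //.
  have -> : map_mx D 1%:M = 0 :> 'M_n.
    by apply/matrixP => i j; rewrite !mxE; case: (i == j); rewrite ?raddf0 ?(derivation1 DM).
  move=> /(congr1 (mulmx (invmx A))); rewrite mulmx0 mulmxDr mulKmx //.
  move/eqP; rewrite eq_sym addrC addr_eq0 mulmxA => /eqP ->.
  by apply/matrixP => i j; rewrite !mxE oppr_pchar2.
have := congr1 (fun M : 'M_n => M q p) DB; rewrite !mxE => ->.
rewrite mulr_suml [RHS]big_mkcond; apply: eq_bigr => r _.
rewrite mxE (bigD1 p0) //= big1 => [|p1 /negPf p1p0]; last first.
  by rewrite mxE DA p1p0 mulr0.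
by rewrite mxE DA eqxx addr0 /=; case: (c r == i0); rewrite ?mulr1 ?mulr0 ?mul0r 1?mulrC.
Qed.

(** Expand along row p0: the cofactors of that row do not contain its entries, and
they are det A times the column p0 of A^-1. *)
Lemma derivation_det :
  D (\det A) = \det A * (\sum_(r | c r == i0) invmx A r p0).
Proof.
rewrite (expand_det_row A p0) raddf_sum -(expand_det_row A p0) mulr_sumr.
rewrite [RHS]big_mkcond; apply: eq_bigr => q _ /=.
rewrite DM DA eqxx /= [D (cofactor _ _ _)](_ : _ = 0) ?mulr0 ?addr0; last first.
  rewrite /cofactor oppr_pchar2 // expr1n mul1r; apply: derivation_det0 => p r.
  by rewrite !mxE DA eq_sym (negPf (neq_lift _ _)).
case: (c q == i0); rewrite ?mul0r // mul1r /invmx A_unit !mxE mulrA divff ?mul1r //.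
by rewrite -unitfE -unitmxE.
Qed.

End DerivationMatrix.

(** * The derivatives of one summand *)

(** Removes the denominator d e at the cost of a square, which is a constant for the
derivations in characteristic 2; the factor d is the one that [iterated_flow]
requires. *)
Lemma div_as_sqr (F : fieldType) (x d e : F) :
  x / (d * e) = d * (x * e) * (d * e)^-1 ^+ 2.
Proof.
have [de0|] := eqVneq (d * e) 0; first by rewrite de0 invr0 expr2 !mulr0.
by rewrite mulf_eq0 negb_or => /andP[d0 e0]; field; rewrite d0 e0.
Qed.

Section SimplexTerm.
Variables (k : fieldType) (n N : nat).
Hypothesis hk : 2%N \in [pchar k].
Local Notation K := {fraction {mpoly k[n * N]}}.
Implicit Types (I J s : n.-tuple 'I_N).

Lemma pchar2_frac : 2%N \in [pchar K].
Proof.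
by apply: (rmorph_pchar (@FracField.tofrac _)); apply: (rmorph_pchar (@mpolyC _ k)).
Qed.

(** The columns of the inverse matrix are extended by 0 to all the vertices: the
formulas for their derivatives then need no case analysis on whether the vertex
of differentiation lies in s. *)
Definition inv_col s (p : 'I_n) (j : 'I_N) : K :=
  \sum_(q | tnth s q == j) invmx (amx k s) q p.

(** The coordinates of the first basis vector, that is, the first column of the
inverse matrix. The sum avoids naming index 0, absent when n = 0. *)
Definition e0_coord s (j : 'I_N) : K := \sum_(p < n | val p == 0%N) inv_col s p j.

Definition simplex_term s (f : {mpoly K[N]}) : K :=
  f.@[e0_coord s] / (\det (amx k s) * \prod_q e0_coord s (tnth s q)).

Definition x_mnm s : 'X_{1..N} := (\sum_q U_(tnth s q))%MM.

Lemma x_mnmE (A : nzRingType) s : x_ A s = 'X_[x_mnm s].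
Proof. by rewrite /x_ /x_mnm; apply/esym/(big_morph _ (@mpolyXD _ _) (@mpolyX0 _ _)). Qed.

Lemma meval_x_ s (v : 'I_N -> K) : (x_ K s).@[v] = \prod_q v (tnth s q).
Proof.
rewrite /x_ (rmorph_prod (meval v)); apply: eq_bigr => q _ /=; exact: mevalXU.
Qed.

Variable s : n.-tuple 'I_N.
Hypothesis us : uniq s.

Lemma inv_col_vertex p q : inv_col s p (tnth s q) = invmx (amx k s) q p.
Proof.
rewrite /inv_col (eq_bigl (pred1 q)) ?big_pred1_eq // => r.
by rewrite (inj_eq (tuple_uniqP _ us)).
Qed.

Lemma inv_col_out p j : j \notin s -> inv_col s p j = 0.
Proof.
move=> js; rewrite /inv_col big1 // => q /eqP sq.
by rewrite -sq mem_tnth in js.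
Qed.

Lemma partial_amx i p0 p q :
  partial_a p0 i (amx k s p q) = ((p == p0) && (tnth s q == i))%:R.
Proof. by rewrite mxE partial_a_var. Qed.

Lemma partial_inv_col i p0 p j :
  partial_a p0 i (inv_col s p j) = inv_col s p i * inv_col s p0 j.
Proof.
rewrite raddf_sum mulr_sumr; apply: eq_bigr => q _ /=.
exact: (derivation_invmx (@partial_aM _ _ _ _ _) pchar2_frac (amx_unit _ us)
  (partial_amx i p0)).
Qed.

Lemma partial_e0_coord i p0 j :
  partial_a p0 i (e0_coord s j) = e0_coord s i * inv_col s p0 j.
Proof.
rewrite raddf_sum mulr_suml; apply: eq_bigr => p _ /=.
exact: partial_inv_col.
Qed.

Lemma partial_det i p0 :
  partial_a p0 i (\det (amx k s)) = \det (amx k s) * inv_col s p0 i.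
Proof.
exact: (derivation_det (@partial_aM _ _ _ _ _) pchar2_frac (amx_unit _ us)
  (partial_amx i p0)).
Qed.

Lemma partial_simplex_term I m :
  partial_ I (simplex_term s 'X_[m]) =
  (dirDs (inv_col s) (enum 'I_n)
    ('X_[x_mnm I + m + x_mnm s] : {mpoly K[N]})).@[e0_coord s] *
  \det (amx k s) / (\det (amx k s) * \prod_q e0_coord s (tnth s q)) ^+ 2.
Proof.
set d := \det _; set P := \prod_q _.
have -> : simplex_term s 'X_[m] =
    d * ('X_[m + x_mnm s] : {mpoly K[N]}).@[e0_coord s] * (d * P)^-1 ^+ 2.
  rewrite /simplex_term -/d -/P mpolyXD mevalM -x_mnmE meval_x_ -/P.
  exact: div_as_sqr.
have pull x u ps : foldr (fun p => partial_a p (tnth I p)) (x * u ^+ 2) ps =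
    foldr (fun p => partial_a p (tnth I p)) x ps * u ^+ 2 :> K.
  elim: ps => //= p ps ->.
  exact: (derivation_mul_sqr (@partial_aM _ _ _ _ _) _ _ pchar2_frac).
rewrite /partial_ pull.
rewrite (@iterated_flow _ _ _ (fun p => @partial_a k n N p (tnth I p)) (tnth I) _ (inv_col s)).
- have -> : (\sum_(p <- enum 'I_n) U_(tnth I p) = x_mnm I)%MM.
    by rewrite big_enum; apply: eq_bigl => p; rewrite inE.
  by rewrite [X in X * _]mulrC exprVn -[in RHS]addmA.
- by move=> p x y; apply: partial_aM.
- by move=> p j; apply: partial_e0_coord.
- by move=> p q j; apply: partial_inv_col.
- by move=> p; apply: partial_det.
Qed.

(** The square x_h^2 comes out of the derivatives, and those of prod_q x_{s_q} leave
the determinant of the inverse matrix. *)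
Lemma partial_simplex_term_square I J h :
  (x_mnm I + x_mnm J = h + h)%MM ->
  partial_ I (simplex_term s (x_ K J)) = simplex_term s 'X_[h] ^+ 2.
Proof.
move=> IJ; rewrite x_mnmE partial_simplex_term IJ !mpolyXD -expr2 -(x_mnmE _ s).
rewrite dirDs_mul => [|p]; last exact/dirD_sqr/pchar2_frac.
rewrite (dirDs_prod (B := (invmx (amx k s))^T)) ?pchar2_frac //; last first.
  by move=> p q; rewrite inv_col_vertex mxE.
rewrite mevalM mevalC det_tr det_inv rmorphXn /= divfK ?det_amx_neq0 //.
by rewrite /simplex_term expr_div_n.
Qed.

(** M is the monomial to be differentiated n times. A variable outside s is never
differentiated and vanishes at the point of evaluation. If there is none, the set
T of the variables with odd exponent in M is contained in s; it is not all of s,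
since x_I x_J would then be a square, and so fewer than n variables remain once
the square part is taken out. *)
Lemma partial_simplex_term_nonsquare I J :
  ~ (exists h, x_mnm I + x_mnm J = h + h)%MM ->
  partial_ I (simplex_term s (x_ K J)) = 0.
Proof.
move=> nsq; rewrite x_mnmE partial_simplex_term.
set M := (_ + x_mnm s)%MM.
suff -> : (dirDs (inv_col s) (enum 'I_n) ('X_[M] : {mpoly K[N]})).@[e0_coord s] = 0.
  by rewrite !mul0r.
have sE j : x_mnm s j = (j \in s) :> nat.
  rewrite mnm_sumE; have [/tnthP[q ->]|js] := boolP (j \in s).
    rewrite (bigD1 q) //= mnm1E eqxx big1 // => r rq.
    by rewrite mnm1E (inj_eq (tuple_uniqP _ us)) (negPf rq).
  by rewrite big1 // => q _; rewrite mnm1E; case: eqP => // sq; rewrite -sq mem_tnth in js.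
have [/existsP[j /andP[js Mj]]|/existsPn sM] := boolP [exists j, (j \notin s) && (0 < M j)%N].
  have -> : M = (U_(j) + (M - U_(j)))%MM.
    by rewrite addmC submK //; apply/mnm_lepP => i; rewrite mnm1E; case: eqP => // <-.
  rewrite mpolyXD dirDs_mul => [|p]; last by rewrite dirDX inv_col_out.
  by rewrite mevalM mevalXU /e0_coord big1 ?mul0r // => p _; rewrite inv_col_out.
pose T := [set j | odd (M j)].
have Ts : T \subset [set j in s].
  apply/subsetP => j; rewrite !inE => Mj; apply: contraLR (sM j) => js.
  by rewrite js negbK; case: (M j) Mj.
have T_small : (#|T| < n)%N.
  have cs : #|[set j in s]| = n by rewrite cardsE (card_uniqP us) size_tuple.
  rewrite -cs; apply: proper_card; rewrite properEneq Ts andbT; apply/eqP => TE.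
  apply: nsq; exists [multinom ((x_mnm I + x_mnm J)%MM j)./2 | j < N].
  apply/mnmP => j; rewrite [RHS]mnmDE !mnmE addnn.
  have /setP/(_ j) := TE; rewrite !inE /M [X in odd X]mnmDE sE oddD oddb mnmDE => oj.
  rewrite -[LHS]odd_double_half; move: oj.
  by case: (odd _); case: (j \in s).
have -> : M = ([multinom (M j)./2 | j < N] *+ 2 + \sum_(q < #|T|) U_(enum_val q))%MM.
  apply/mnmP => j; rewrite mnmDE mulmnE mnmE mnm_sumE muln2 addnC.
  rewrite -[LHS]odd_double_half; congr (_ + _)%N.
  rewrite -(big_enum_val (fun i => U_(i)%MM j)).
  rewrite (eq_bigr (fun i => (i == j) : nat)) => [|i _]; last exact: mnm1E.
  rewrite -big_mkcondr (eq_bigl (fun i => (i == j) && (j \in T))) => [|i]; last first.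
    by rewrite andbC; case: eqP => // ->.
  by rewrite big_mkcondr (big_pred1 j) // inE.
rewrite mpolyXD -mpolyXn dirDs_mul => [|p]; last exact/dirD_sqr/pchar2_frac.
rewrite (big_morph _ (@mpolyXD _ _) (@mpolyX0 _ _)) dirDs_prod_small ?mulr0 ?meval0 //.
by rewrite size_enum_ord.
Qed.

End SimplexTerm.

(** * Partial fractions *)

Section PartialFractions.
Variable F : fieldType.
Implicit Types (p q g : {poly F}) (d e : nat).

(** The coefficient of degree d under a bound on the degree, rather than the leading
coefficient: c may be 0, which makes the notion multiplicative without
nonvanishing hypotheses. *)
Definition has_top d p (c : F) := (size p <= d.+1)%N /\ p`_d = c.

Lemma has_topM d e p q a b :
  has_top d p a -> has_top e q b -> has_top (d + e) (p * q) (a * b).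
Proof.
move=> [sp <-] [sq <-]; split.
  apply: leq_trans (size_polyMleq _ _) _.
  by rewrite -subn1 leq_subLR add1n -addnS -addSn leq_add.
rewrite coefM (bigD1 (inord d)) //= inordK ?ltnS ?leq_addr // addKn.
rewrite big1 ?addr0 // => i; rewrite -val_eqE /= inordK ?ltnS ?leq_addr // => id.
have [di|di] := ltnP d i; first by rewrite [p`_i]nth_default ?mul0r // (leq_trans sp).
rewrite [q`__]nth_default ?mulr0 // (leq_trans sq) // ltn_subRL ltn_add2r.
by rewrite ltn_neqAle id.
Qed.

Lemma has_top_prod (I : Type) (r : seq I) (P : pred I) (d : I -> nat)
    (p : I -> {poly F}) (c : I -> F) :
  (forall i, P i -> has_top (d i) (p i) (c i)) ->
  has_top (\sum_(i <- r | P i) d i) (\prod_(i <- r | P i) p i) (\prod_(i <- r | P i) c i).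
Proof.
move=> top; elim: r => [|i r IH].
  by rewrite !big_nil; split; rewrite ?size_poly1 ?coef1.
by rewrite !big_cons; case: ifP => // Pi; apply: has_topM => //; apply: top.
Qed.

Lemma has_top_linear (a b : F) : has_top 1 (a%:P - b *: 'X) (- b).
Proof.
split; last by rewrite coefB coefC coefZ coefX mulr1 sub0r.
rewrite (leq_trans (size_polyD _ _)) // geq_max (leq_trans (size_polyC_leq1 _)) //.
by rewrite size_polyN (leq_trans (size_scale_leq _ _)) // size_polyX.
Qed.

Lemma has_top_exp d p c k : has_top d p c -> has_top (d * k) (p ^+ k) (c ^+ k).
Proof.
move=> top; elim: k => [|k IH]; last by rewrite mulnS !exprS; apply: has_topM.
by rewrite muln0 !expr0; split; rewrite ?size_poly1 ?coef1.
Qed.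

(** The residues of g(z) / (z . prod_i (x_i - z y_i)) sum to 0. The poles are 0 and
the x_j / y_j, and the last term is the contribution of infinity. *)
Lemma partial_fractions n (x y : 'I_n -> F) g :
  (forall i, x i != 0) -> (forall i, y i != 0) ->
  (forall i j, i != j -> x i * y j != x j * y i) -> (size g <= n.+1)%N ->
  g.[0] / \prod_i x i =
  \sum_j g.[x j / y j] / (x j * \prod_(i | i != j) (x i - x j / y j * y i)) +
  g`_n / \prod_i - y i.
Proof.
move=> x0 y0 xy sg.
pose l i := (x i)%:P - y i *: 'X.
have lE i z : (l i).[z] = x i - z * y i by rewrite !hornerE mulrC.
have l_node j : (l j).[x j / y j] = 0 by rewrite lE divfK ?subrr.
pose w j := \prod_(i | i != j) (x i - x j / y j * y i).
have w0 j : w j != 0.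
  apply/prodf_neq0 => i ij; rewrite subr_eq0; apply: contra (xy _ _ ij) => /eqP ->.
  by rewrite mulrAC divfK.
pose c j := g.[x j / y j] / (x j / y j * w j).
(* h interpolates g at the n + 1 nodes 0 and x j / y j; comparing the coefficients
   of degree n of h and g gives the identity. *)
pose h := (g.[0] / \prod_i x i)%:P * \prod_i l i +
  \sum_j (c j)%:P * ('X * \prod_(i | i != j) l i).
have top1 : has_top n (\prod_i l i) (\prod_i - y i).
  have := @has_top_prod _ (index_enum 'I_n) predT (fun=> 1%N) l (fun i => - y i).
  by rewrite sum1_card card_ord; apply=> i _; apply: has_top_linear.
have top2 j : has_top n ('X * \prod_(i | i != j) l i) (\prod_(i | i != j) - y i).
  have := @has_top_prod _ (index_enum 'I_n) (predC1 j) (fun=> 1%N) l (fun i => - y i).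
  rewrite sum1_card cardC1 card_ord => /(_ (fun i _ => has_top_linear _ _)) top.
  have topX : has_top 1 ('X : {poly F}) 1 by split; rewrite ?size_polyX ?coefX.
  have := has_topM topX top; rewrite mul1r add1n prednK //.
  by case: n j {x y x0 y0 xy sg l lE l_node w w0 c h top1 top} => [[]|].
have hg : h = g.
  pose nodes := 0 :: [seq x j / y j | j <- enum 'I_n].
  apply/eqP; rewrite -subr_eq0; apply/eqP.
  apply: (@roots_geq_poly_eq0 _ _ nodes).
  - rewrite /nodes /= all_map; apply/andP; split.
      rewrite /root hornerD hornerN {1}/h hornerD horner_sum hornerM hornerC horner_prod.
      rewrite [X in _ + X - _]big1 => [|j _]; last by rewrite !hornerM hornerX !(mul0r, mulr0).
      under [\prod_i (l i).[0]]eq_bigr do rewrite lE mul0r subr0.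
      by rewrite divfK ?addr0 ?subrr //; apply/prodf_neq0.
    apply/allP => j _ /=.
    rewrite /root hornerD hornerN {1}/h hornerD horner_sum hornerM horner_prod.
    rewrite [\prod_i (l i).[_]](bigD1 j) //= l_node mul0r mulr0 add0r.
    rewrite [\sum_i _](bigD1 j) //= [X in _ + X - _]big1 => [|i ij]; last first.
      by rewrite !hornerM horner_prod (bigD1 j) 1?eq_sym //= l_node mul0r !mulr0.
    rewrite !hornerM hornerC hornerX horner_prod addr0.
    under [\prod_(i | _) (l i).[_]]eq_bigr do rewrite lE.
    by rewrite -/(w j) divfK ?subrr // mulf_neq0 ?w0 ?mulf_neq0 ?invr_eq0.
  - rewrite /= map_inj_uniq ?enum_uniq ?andbT; last first.
      move=> i j /eqP; rewrite eqr_div // => eij; apply/eqP.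
      by apply: contraTT eij => ij; rewrite xy.
    by apply/mapP => -[j _ /esym/eqP]; rewrite mulf_eq0 invr_eq0 (negPf (x0 j)) (negPf (y0 j)).
  rewrite /nodes /= size_map size_enum_ord.
  rewrite (leq_trans (size_polyD _ _)) // geq_max size_polyN sg andbT.
  rewrite (leq_trans (size_polyD _ _)) // geq_max; apply/andP; split.
    by rewrite mul_polyC (leq_trans (size_scale_leq _ _)) ?top1.1.
  rewrite (leq_trans (size_sum _ _ _)) //; apply/bigmax_leqP => j _.
  by rewrite mul_polyC (leq_trans (size_scale_leq _ _)) ?(top2 j).1.
have := congr1 (fun p : {poly F} => p`_n) hg.
rewrite coefD coefCM top1.2 coef_sum => <-.
rewrite mulrDl mulfK; last by apply/prodf_neq0 => i _; rewrite oppr_eq0.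
rewrite addrCA -[LHS]addr0; congr (_ + _).
rewrite mulr_suml -big_split big1 // => j _ /=.
rewrite coefCM (top2 j).2 -/(w j) [\prod_i - y i](bigD1 j) //=.
have Y0 : \prod_(i < n | i != j) - y i != 0 by apply/prodf_neq0 => i _; rewrite oppr_eq0.
by rewrite /c; field; rewrite Y0 y0 x0 w0 oppr_eq0 ?y0.
Qed.

End PartialFractions.

(** * Coordinates of a vector in a simplex *)

Section Coordinates.
Variables (F : fieldType) (n N : nat) (A : 'M[F]_(n, N)).
Implicit Types (s : n.-tuple 'I_N) (u : 'cV[F]_n) (v : 'I_N -> F).

Definition simplex_mx s : 'M[F]_n := colsub (tnth s) A.

Definition coord s u (q : 'I_n) : F := (invmx (simplex_mx s) *m u) q 0.

(** Extending the coordinates by 0 to all the vertices makes the coordinates in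
different simplices comparable; see [ext_uniq]. *)
Definition ext s u (j : 'I_N) : F := \sum_(q | tnth s q == j) coord s u q.

Lemma coordD s u u' c q : coord s (u - c *: u') q = coord s u q - c * coord s u' q.
Proof. by rewrite /coord mulmxBr -scalemxAr !mxE. Qed.

Lemma extD s u u' c j : ext s (u - c *: u') j = ext s u j - c * ext s u' j.
Proof.
rewrite /ext mulr_sumr -sumrB; apply: eq_bigr => q _; exact: coordD.
Qed.

Variable s : n.-tuple 'I_N.
Hypothesis us : uniq s.

Lemma ext_vertex u q : ext s u (tnth s q) = coord s u q.
Proof.
rewrite /ext (eq_bigl (pred1 q)) ?big_pred1_eq // => r.
by rewrite (inj_eq (tuple_uniqP _ us)).
Qed.

Lemma ext_out u j : j \notin s -> ext s u j = 0.
Proof.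
move=> js; rewrite /ext big1 // => q /eqP sq.
by rewrite -sq mem_tnth in js.
Qed.

Hypothesis s_unit : simplex_mx s \in unitmx.

Lemma sum_supported v p : (forall j, j \notin s -> v j = 0) ->
  \sum_j A p j * v j = \sum_q A p (tnth s q) * v (tnth s q).
Proof.
move=> vs; rewrite (bigID (mem s)) /= addrC big1 => [|j /vs ->]; last exact: mulr0.
by rewrite add0r -big_uniq // big_tuple.
Qed.

Lemma ext_comb u p : \sum_j A p j * ext s u j = u p 0.
Proof.
rewrite sum_supported => [|j]; last exact: ext_out.
transitivity ((simplex_mx s *m (invmx (simplex_mx s) *m u)) p 0); last by rewrite mulKVmx.
by rewrite mxE; apply: eq_bigr => q _; rewrite ext_vertex mxE.
Qed.

Lemma ext_uniq u v : (forall j, j \notin s -> v j = 0) ->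
  (forall p, \sum_j A p j * v j = u p 0) -> v =1 ext s u.
Proof.
move=> vs vu j; have [/tnthP[q ->]|js] := boolP (j \in s); last by rewrite vs ?ext_out.
rewrite ext_vertex; pose w := \col_q v (tnth s q).
have -> : u = simplex_mx s *m w.
  apply/colP => p; rewrite -vu sum_supported // mxE.
  by apply: eq_bigr => r _; rewrite !mxE.
by rewrite /coord mulKmx // mxE.
Qed.

(** Cramer's rule, with the numerator expanded along its column u: the minors depend
only on the ridge opposite to the vertex q. *)
Lemma coord_cramer u q : 2%N \in [pchar F] ->
  coord s u q * \det (simplex_mx s) =
  \sum_p \det (row' p (colsub (fun r => tnth s (lift q r)) A)) * u p 0.
Proof.
move=> ch; rewrite /coord /invmx s_unit -scalemxAl mxE mulrAC mulVf ?mul1r; last first.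
  by rewrite -unitfE -unitmxE.
rewrite mxE; apply: eq_bigr => p _; rewrite mxE /cofactor oppr_pchar2 // expr1n mul1r.
by congr (\det _ * _); apply/matrixP => i j; rewrite !mxE.
Qed.

End Coordinates.

(** Two facets with a common ridge list its vertices in the same order, so that the
minors of [coord_cramer] are equal, not merely equal up to sign. *)
Lemma ridge_vertices n N (s s' : n.-tuple 'I_N) (q q' : 'I_n) :
  sorted ltn [seq val j | j <- s] -> sorted ltn [seq val j | j <- s'] ->
  [set j in s] :\ tnth s q = [set j in s'] :\ tnth s' q' ->
  forall r, tnth s (lift q r) = tnth s' (lift q' r).
Proof.
pose f (t : n.-tuple 'I_N) p := [tuple tnth t (lift p r) | r < n.-1].
have f_mem (t : n.-tuple 'I_N) p : uniq t -> f t p =i [set j in t] :\ tnth t p.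
  move=> ut j; apply/tnthP/idP => [[r ->]|].
    rewrite tnth_mktuple !inE mem_tnth andbT (inj_eq (tuple_uniqP _ ut)).
    by rewrite eq_sym neq_lift.
  rewrite !inE => /andP[jp /tnthP[r jr]]; move: jp; rewrite jr (inj_eq (tuple_uniqP _ ut)).
  rewrite eq_sym => /unlift_some[r' -> _].
  by exists r'; rewrite tnth_mktuple.
have f_sorted (t : n.-tuple 'I_N) p : sorted ltn [seq val j | j <- t] ->
    sorted ltn [seq val j | j <- f t p].
  move=> st; rewrite /= -map_comp.
  apply: (homo_sorted (e := relpre val ltn)).
    move=> i j /= ij.
    have := sorted_ltn_nth ltn_trans 0%N st.
    move=> /(_ (lift p i) (lift p j)); rewrite !inE !size_map size_tuple.
    rewrite !ltn_ord => /(_ isT isT).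
    rewrite !(nth_map (tnth s q)) ?size_tuple // -!tnth_nth; apply.
    by rewrite /= ltnNge leq_bump2 -ltnNge.
  by rewrite -sorted_map val_enum_ord iota_ltn_sorted.
move=> ss ss' e r.
have us (t : n.-tuple 'I_N) : sorted ltn [seq val j | j <- t] -> uniq t.
  by move=> /(sorted_uniq ltn_trans ltnn); rewrite map_inj_uniq //; apply: val_inj.
suff ff' : f s q = f s' q'.
  by have := congr1 (fun t => tnth t r) ff'; rewrite !tnth_mktuple.
apply/val_inj/(inj_map val_inj)/(irr_sorted_eq ltn_trans ltnn); try exact: f_sorted.
move=> i; apply/mapP/mapP => -[j jf ->]; exists j => //; move: jf.
  by rewrite !f_mem ?us // e.
by rewrite !f_mem ?us // -e.
Qed.

(** * Cancellation along the ridges *)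

Section Invariance.
Variables (F : fieldType) (n N : nat) (A : 'M[F]_(n, N)) (D : {set {set 'I_N}}).
Hypothesis ch : 2%N \in [pchar F].
Variables (t e : 'cV[F]_n) (m : 'X_{1..N}).
Hypothesis m_deg : mdeg m = n.
Implicit Types (s : n.-tuple 'I_N) (u : 'cV[F]_n) (T G : {set 'I_N}).

Definition facet_term s u : F :=
  (\prod_j ext A s u j ^+ m j) / (\det (simplex_mx A s) * \prod_q coord A s u q).

(** The value of z for which t - z e is spanned by the ridge opposite to q. *)
Definition slope s q := coord A s t q / coord A s e q.

Definition ridge_term s q : F :=
  (\prod_j ext A s (t - slope s q *: e) j ^+ m j) /
  (\det (simplex_mx A s) *
   (coord A s t q * \prod_(r | r != q) coord A s (t - slope s q *: e) r)).

Definition ridge s q : {set 'I_N} := [set j in s] :\ tnth s q.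

Hypothesis A_unit : forall s, s \in ordered_facets n D -> simplex_mx A s \in unitmx.
Hypothesis t_neq0 : forall s q, s \in ordered_facets n D -> coord A s t q != 0.
Hypothesis e_neq0 : forall s q, s \in ordered_facets n D -> coord A s e q != 0.
Hypothesis te_neq : forall s q r, s \in ordered_facets n D -> q != r ->
  coord A s t q * coord A s e r != coord A s t r * coord A s e q.

(** Partial fractions of f(x - z y) / (z . prod_q (x_q - z y_q)), where f is the
monomial of exponent m: as f has degree n, the value at infinity is f(y) up to
sign. *)
Lemma facet_term_ridges s : s \in ordered_facets n D ->
  facet_term s t = facet_term s e + \sum_q ridge_term s q.
Proof.
move=> sD; pose g : {poly F} :=
  \prod_j ((ext A s t j)%:P - ext A s e j *: 'X) ^+ m j.
have gE z : g.[z] = \prod_j ext A s (t - z *: e) j ^+ m j.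
  rewrite horner_prod; apply: eq_bigr => j _.
  by rewrite horner_exp !hornerE extD mulrC.
have := @has_top_prod _ _ (index_enum 'I_N) predT _ _ _
  (fun j _ => has_top_exp (m j) (has_top_linear (ext A s t j) (ext A s e j))).
under eq_bigr do rewrite mul1n; rewrite -mdegE m_deg -/g => -[sg gn].
have := partial_fractions (fun q => t_neq0 q sD) (fun q => e_neq0 q sD)
  (fun q r => @te_neq s q r sD) sg.
rewrite gn gE scale0r subr0 /facet_term.
under [X in _ = _ + X / _ -> _]eq_bigr do rewrite oppr_pchar2 //.
under [X in _ = _ + _ / X -> _]eq_bigr do rewrite oppr_pchar2 //.
have div_det a b : a / (\det (simplex_mx A s) * b) = (\det (simplex_mx A s))^-1 * (a / b).
  by rewrite invfM mulrCA.
rewrite !div_det => ->; rewrite mulrDr addrC; congr (_ + _).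
rewrite mulr_sumr; apply: eq_bigr => q _; rewrite gE /ridge_term div_det.
by congr (_ * (_ / (_ * _))); apply: eq_bigr => r _; rewrite coordD.
Qed.

(** The vector v of coordinates of t - slope e is supported on the ridge, hence it is
also its vector of coordinates in s'. It vanishes at the vertex q' of s', which
forces the slopes to agree. *)
Lemma ridge_term_eq s s' q q' :
  s \in ordered_facets n D -> s' \in ordered_facets n D ->
  ridge s q = ridge s' q' -> ridge_term s q = ridge_term s' q'.
Proof.
move=> sD s'D ss'.
have us := ordered_facets_uniq sD; have us' := ordered_facets_uniq s'D.
pose v := ext A s (t - slope s q *: e).
have v_ridge j : j \notin ridge s q -> v j = 0.
  rewrite !inE negb_and negbK => /orP[/eqP->|]; last exact: ext_out.
  by rewrite /v ext_vertex // coordD divfK ?subrr // e_neq0.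
have vE : v =1 ext A s' (t - slope s q *: e).
  apply: ext_uniq => // [|j js'|p]; first exact: A_unit.
    by rewrite v_ridge // ss' !inE (negPf js') andbF.
  by rewrite ext_comb // A_unit.
have slopeE : slope s q = slope s' q'.
  have : v (tnth s' q') = 0 by rewrite v_ridge // ss' !inE eqxx.
  rewrite vE ext_vertex // coordD => /eqP; rewrite subr_eq0 => /eqP vq.
  by rewrite /slope [in RHS]vq mulfK // e_neq0.
have vE' : v =1 ext A s' (t - slope s' q' *: e) by move=> j; rewrite vE slopeE.
have prod_ridge s1 q1 : s1 \in ordered_facets n D ->
    \prod_(r | r != q1) coord A s1 (t - slope s1 q1 *: e) r =
    \prod_(j in ridge s1 q1) ext A s1 (t - slope s1 q1 *: e) j.
  move=> s1D; have us1 := ordered_facets_uniq s1D.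
  have -> : ridge s1 q1 = [set tnth s1 r | r in [set~ q1]].
    apply/setP => j; rewrite !inE; apply/andP/imsetP => [[jq /tnthP[r jr]]|[r]].
      by exists r; rewrite // !inE; apply: contraNneq jq => <-; rewrite jr.
    by rewrite !inE => rq ->; rewrite mem_tnth (inj_eq (tuple_uniqP _ us1)).
  rewrite big_imset /=; last by move=> r r' _ _; apply: (tuple_uniqP _ us1).
  by apply: eq_big => r; rewrite ?inE // ext_vertex.
have detE : coord A s e q * \det (simplex_mx A s) =
    coord A s' e q' * \det (simplex_mx A s').
  rewrite !coord_cramer ?A_unit //; apply: eq_bigr => p _; congr (\det _ * _).
  have ridges : forall r, tnth s (lift q r) = tnth s' (lift q' r).
    by apply: ridge_vertices => //; [move: sD|move: s'D]; rewrite inE => /andP[].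
  by apply/matrixP => i r; rewrite !mxE ridges.
rewrite /ridge_term; congr (_ / _); first by apply: eq_bigr => j _; rewrite -vE'.
have denomE s1 q1 P : s1 \in ordered_facets n D ->
    \det (simplex_mx A s1) * (coord A s1 t q1 * P) =
    slope s1 q1 * (coord A s1 e q1 * \det (simplex_mx A s1)) * P.
  move=> s1D; have -> : coord A s1 t q1 = slope s1 q1 * coord A s1 e q1.
    by rewrite divfK ?e_neq0.
  ring.
rewrite !denomE // !prod_ridge // detE ss' [in LHS]slopeE; congr (_ * _).
by apply: eq_bigr => j _; rewrite -vE' /v slopeE.
Qed.

Hypothesis D_complex : simplicial_complex D.
Hypothesis D_pure : forall G, G \in facets D -> #|G| = n.
Hypothesis D_ridges : forall T, T \in D -> #|T|.+1 = n ->
  #|[set G in D | (#|G| == n) && (T \subset G)]| = 2%N.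

Lemma facet_card G : G \in D -> #|G| = n -> G \in facets D.
Proof.
move=> GD Gn; rewrite inE; apply/maxsetP; split=> // H HD GH.
have [M /maxsetP[MD Mmax] HM] := @maxset_exists _ (fun G => G \in D) H HD.
have Mn : #|M| = n by apply: D_pure; rewrite inE; apply/maxsetP.
apply/eqP; rewrite eq_sym eqEcard GH Gn -Mn.
by apply: subset_leq_card.
Qed.

(** The pairs (s, q) with ridge T correspond to the facets that contain T, because a
facet exceeds T by exactly one vertex. *)
Lemma card_ridge_pairs T : T \in D -> #|T|.+1 = n ->
  #|[set x : n.-tuple 'I_N * 'I_n |
      (x.1 \in ordered_facets n D) && (ridge x.1 x.2 == T)]| = 2%N.
Proof.
move=> TD Tn; rewrite -(D_ridges TD Tn).
have [inj im] := ordered_facetsP D_pure.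
rewrite -(card_in_imset (f := fun x : n.-tuple 'I_N * 'I_n => [set j in x.1])).
  apply: eq_card => G; rewrite !inE; apply/imsetP/idP.
    move=> [[s q]]; rewrite inE /= => /andP[sD /eqP <-] ->.
    have sF : [set j in s] \in facets D by rewrite -im; apply: imset_f.
    rewrite (D_pure sF) eqxx subsetDl !andbT.
    by move: sF; rewrite inE => /maxsetP[].
  move=> /and3P[GD /eqP Gn TG].
  have : G \in [set [set j in s] | s : n.-tuple 'I_N in ordered_facets n D].
    by rewrite im facet_card.
  case/imsetP => s sD Gs.
  have : exists2 j, j \in G & j \notin T.
    apply/subsetPn; apply/negP => /subset_leq_card; rewrite Gn -Tn ltnn.
    by [].
  move=> [j]; rewrite Gs inE => /tnthP[q ->] sqT.
  exists (s, q) => //; rewrite inE sD /= eq_sym eqEcard.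
  rewrite subsetD1 -Gs TG sqT /= /ridge -Gs -ltnS Tn.
  suff : (#|G :\ tnth s q| < #|G|)%N by rewrite Gn.
  by rewrite [X in (_ < X)%N](cardsD1 (tnth s q)) {2}Gs inE mem_tnth.
move=> [s q] [s' q']; rewrite inE /= => /andP[sD /eqP sq].
rewrite inE /= => /andP[s'D /eqP s'q'] e0.
have ss' : s = s' by exact: (inj _ _ sD s'D e0).
congr (_, _) => //; rewrite -ss' in s'q'.
apply: (tuple_uniqP _ (ordered_facets_uniq sD)).
apply/eqP; apply: contraT => qq'.
have /setP/(_ (tnth s q)) := etrans sq (esym s'q').
by rewrite !inE eqxx mem_tnth /= andbT qq'.
Qed.

(** Every ridge lies in two facets, which contribute the same term. *)
Lemma sum_ridge_terms :
  \sum_(s in ordered_facets n D) \sum_q ridge_term s q = 0.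
Proof.
rewrite pair_big_dep /= (partition_big (fun x => ridge x.1 x.2) predT) //=.
rewrite big1 // => T _.
have [[s0 q0] /= /andP[/andP[s0D _] /eqP s0T]|none] := pickP
  (fun x : n.-tuple 'I_N * 'I_n =>
    (x.1 \in ordered_facets n D) && true && (ridge x.1 x.2 == T)); last first.
  by rewrite big_pred0.
rewrite (eq_bigr (fun=> ridge_term s0 q0)) => [|[s q] /= /andP[/andP[sD _] /eqP sT]]; last first.
  by apply: ridge_term_eq; rewrite // sT.
have s0F : [set j in s0] \in facets D by move: s0D; rewrite inE => /andP[].
have s0_in : tnth s0 q0 \in [set j in s0] by rewrite inE mem_tnth.
have ridge_D : ridge s0 q0 \in D.
  case: D_complex => _ _; apply; last exact: subsetDl.
  by move: s0F; rewrite inE => /maxsetP[].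
have ridge_card : #|ridge s0 q0|.+1 = n.
  by rewrite -(D_pure s0F) (cardsD1 (tnth s0 q0) [set j in s0]) s0_in.
rewrite sumr_const (_ : #|_| = 2%N) ?mulr2n ?addrr_pchar2 //.
rewrite -[RHS](card_ridge_pairs ridge_D ridge_card); apply: eq_card => x.
by rewrite [RHS]inE s0T unfold_in andbT.
Qed.

Lemma sum_facet_terms :
  \sum_(s in ordered_facets n D) facet_term s t =
  \sum_(s in ordered_facets n D) facet_term s e.
Proof.
rewrite (eq_bigr _ facet_term_ridges) big_split /=.
by rewrite sum_ridge_terms addr0.
Qed.

End Invariance.

(** * The mixed volume as an element of the base field *)

(** Specializing the variable a_{f p, g p} to 1 for all p, and all the others to 0,
turns the matrix into the identity. *)
Lemma generic_minor_neq0 (k : fieldType) n N m (f : 'I_m -> 'I_n) (g : 'I_m -> 'I_N) :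
  injective f -> injective g -> \det (\matrix_(p, q) a_ k (f p) (g q)) != 0.
Proof.
move=> f_inj g_inj.
pose B := \matrix_(p, q) 'X_(mxvec_index (f p) (g q)) : 'M[{mpoly k[n * N]}]_m.
have -> : \matrix_(p, q) a_ k (f p) (g q) = map_mx (@FracField.tofrac _) B.
  by apply/matrixP=> p q; rewrite !mxE.
rewrite det_map_mx tofrac_eq0; apply: contraTneq isT => B0.
pose v := mxvec (\matrix_(i, j) [exists p, (f p == i) && (g p == j)]%:R : 'M[k]_(n, N)) 0.
have : \det (map_mx (meval v) B) = 0 by rewrite det_map_mx /= B0 raddf0.
suff -> : map_mx (meval v) B = 1%:M by rewrite det1 => /eqP; rewrite oner_eq0.
apply/matrixP => p q; rewrite !mxE mevalXU /v mxvecE mxE; congr (nat_of_bool _)%:R.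
apply/existsP/eqP => [[r]|->]; last by exists q; rewrite !eqxx.
by rewrite (inj_eq f_inj) (inj_eq g_inj) => /andP[/eqP <- /eqP <-].
Qed.

Section Linking.
Variables (k : fieldType) (n N : nat).
Local Notation K := {fraction {mpoly k[n * N]}}.
Local Notation F := {fraction {mpoly K[n]}}.
Implicit Types (s : n.-tuple 'I_N) (m : 'X_{1..N}).

Definition const_frac (c : K) : F := (c%:MP)%:F.

HB.instance Definition _ := GRing.RMorphism.copy const_frac
  ((@FracField.tofrac {mpoly K[n]}) \o (@mpolyC n K)).

(** The matrix of the variables a_{p,j}, over the field of rational functions in t. *)
Definition generic_mx : 'M[F]_(n, N) := \matrix_(p, j) const_frac (a_ k p j).
Definition t_vec : 'cV[F]_n := \col_p ('X_p)%:F.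
Definition e0_vec : 'cV[F]_n := \col_p (val p == 0%N)%:R.

Lemma simplex_mx_generic s : simplex_mx generic_mx s = map_mx const_frac (amx k s).
Proof. by apply/matrixP => p q; rewrite !mxE. Qed.

Lemma coord_generic s u q :
  coord generic_mx s u q = \sum_p const_frac (invmx (amx k s) q p) * u p 0.
Proof.
rewrite /coord simplex_mx_generic -map_invmx mxE.
by apply: eq_bigr => p _; rewrite mxE.
Qed.

(** The coordinates of the generic vector t, as linear forms in t. *)
Definition form s q : {mpoly K[n]} := \sum_p invmx (amx k s) q p *: 'X_p.

Lemma coord_t s q : coord generic_mx s t_vec q = (form s q)%:F.
Proof.
rewrite coord_generic /form rmorph_sum; apply: eq_bigr => p _ /=.
by rewrite -mul_mpolyC tofracM mxE.
Qed.

Lemma ext_e0 s j : ext generic_mx s e0_vec j = const_frac (e0_coord k s j).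
Proof.
rewrite /ext /e0_coord rmorph_sum /=.
under eq_bigr do rewrite coord_generic.
rewrite exchange_big [RHS]big_mkcond /=; apply: eq_bigr => p _.
rewrite /inv_col rmorph_sum /=; case: ifP => p0.
  by apply: eq_bigr => q _; rewrite mxE p0 mulr1.
by rewrite big1 // => q _; rewrite mxE p0 mulr0.
Qed.

Lemma facet_term_e0 s m : uniq s ->
  facet_term generic_mx m s e0_vec = const_frac (simplex_term s 'X_[m]).
Proof.
move=> us; rewrite /facet_term /simplex_term fmorph_div rmorphM mevalX.
rewrite rmorph_prod rmorph_prod simplex_mx_generic det_map_mx /=.
congr (_ / (_ * _)).
  by apply: eq_bigr => j _; rewrite ext_e0 rmorphXn.
by apply: eq_bigr => q _; rewrite -ext_e0 ext_vertex.
Qed.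

(** Substitution of the coordinates of t for the variables; naming it gives it a
ring morphism structure. *)
Definition at_t s (g : {mpoly K[n]}) : F := (phi_inv s g)%:F.

HB.instance Definition _ s := GRing.RMorphism.copy (at_t s)
  ((@FracField.tofrac {mpoly K[n]}) \o
   comp_mpoly [tuple \sum_p invmx (amx k s) q p *: 'X_p | q < n]).

Lemma at_t_var s q : at_t s 'X_q = coord generic_mx s t_vec q.
Proof. by rewrite coord_t /at_t /phi_inv comp_mpolyXU -tnth_nth tnth_mktuple. Qed.

Lemma facet_term_t s m :
  (f_at s ('X_[m] : {mpoly K[N]}))%:F / (chi k s)%:F = facet_term generic_mx m s t_vec.
Proof.
congr (_ / _).
  rewrite /f_at /restrict comp_mpolyX -/(at_t s _) (rmorph_prod (at_t s)) /=.
  apply: eq_bigr => j _; rewrite (rmorphXn (at_t s)) /= tnth_mktuple; congr (_ ^+ _).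
  rewrite (rmorph_sum (at_t s)) /ext; apply: eq_bigr => q _ /=.
  exact: at_t_var.
rewrite /chi -mul_mpolyC tofracM simplex_mx_generic det_map_mx; congr (_ * _).
rewrite -/(at_t s _) (rmorph_prod (at_t s)); apply: eq_bigr => q _ /=.
exact: at_t_var.
Qed.

(** The forms are the rows of an invertible matrix: evaluating them at a column of
its inverse picks out one coefficient. *)
Lemma forms_free s (c : 'I_n -> K) : uniq s ->
  \sum_q const_frac (c q) * coord generic_mx s t_vec q = 0 -> forall q, c q = 0.
Proof.
move=> us sum0 r.
have /eqP : (\sum_q c q *: form s q)%:F = 0.
  rewrite -[RHS]sum0 rmorph_sum; apply: eq_bigr => q _ /=.
  by rewrite coord_t -mul_mpolyC tofracM.
rewrite tofrac_eq0 => /eqP/(congr1 (meval (fun p => amx k s p r))).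
rewrite meval0 raddf_sum (bigD1 r) //= => <-.
have form_r q : (form s q).@[fun p => amx k s p r] = (q == r)%:R.
  transitivity ((invmx (amx k s) *m amx k s) q r); last by rewrite mulVmx ?amx_unit // mxE.
  rewrite raddf_sum mxE; apply: eq_bigr => p _ /=.
  by rewrite mevalZ mevalXU.
rewrite big1 => [|q qr]; last by rewrite mevalZ form_r (negPf qr) mulr0.
by rewrite mevalZ form_r eqxx mulr1 addr0.
Qed.

Hypothesis hk : 2%N \in [pchar k].

Lemma coord_t_neq0 s q : uniq s -> coord generic_mx s t_vec q != 0.
Proof.
move=> us; apply/eqP => t0.
have := @forms_free s (fun r => (r == q)%:R) us.
rewrite (bigD1 q) //= t0 mulr0 big1 => [|r /negPf ->]; last by rewrite rmorph0 mul0r.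
by rewrite addr0 => /(_ erefl q)/eqP; rewrite eqxx oner_eq0.
Qed.

(** Up to sign, these coordinates are minors of the matrix of s divided by its
determinant. *)
Lemma e0_coord_neq0 s q : uniq s -> e0_coord k s (tnth s q) != 0.
Proof.
move=> us; rewrite /e0_coord; under eq_bigr do rewrite inv_col_vertex //.
case: n s q us => [|n'] s q us; first by case: q.
rewrite (big_pred1 ord0) // /invmx amx_unit // !mxE mulf_neq0 ?invr_eq0 ?det_amx_neq0 //.
rewrite /cofactor mulf_neq0 ?expf_neq0 ?oppr_eq0 ?oner_eq0 //.
have := @generic_minor_neq0 k n'.+1 N n' (lift ord0) (fun r => tnth s (lift q r))
  (@lift_inj _ _) (inj_comp (tuple_uniqP _ us) (@lift_inj _ _)).
by congr (\det _ != 0); apply/matrixP => i j; rewrite !mxE.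
Qed.

Lemma coord_e0 s q : uniq s ->
  coord generic_mx s e0_vec q = const_frac (e0_coord k s (tnth s q)).
Proof. by move=> us; rewrite -ext_e0 ext_vertex. Qed.

Lemma coord_cross_neq s q r : uniq s -> q != r ->
  coord generic_mx s t_vec q * coord generic_mx s e0_vec r !=
  coord generic_mx s t_vec r * coord generic_mx s e0_vec q.
Proof.
move=> us qr; apply/eqP; rewrite !coord_e0 // => cross.
pose c i := if i == q then e0_coord k s (tnth s r)
            else if i == r then - e0_coord k s (tnth s q) else 0.
have := @forms_free s c us.
rewrite (bigD1 q) // (bigD1 r) 1?eq_sym //= /c eqxx eq_sym (negPf qr) eqxx.
rewrite big1 => [|i /andP[/negPf -> /negPf ->]]; last by rewrite rmorph0 mul0r.
rewrite rmorphN mulNr addr0 mulrC cross mulrC subrr => /(_ erefl q).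
by rewrite eqxx => /eqP; apply/negP/e0_coord_neq0.
Qed.

(** The sum that defines W does not change when t is replaced by a vector with
constant entries, and it then lies in K. *)
Lemma mixed_volume_monomial (D : {set {set 'I_N}}) m :
  simplicial_complex D -> (forall G, G \in facets D -> #|G| = n) ->
  (forall T, T \in D -> #|T|.+1 = n ->
    #|[set G in D | (#|G| == n) && (T \subset G)]| = 2%N) ->
  mdeg m = n ->
  mixed_volume D ('X_[m] : {mpoly K[N]}) =
  \sum_(s in ordered_facets n D) simplex_term s 'X_[m].
Proof.
move=> DC Dp Dr m_deg; apply: mixed_volumeE.
rewrite -[RHS]/(const_frac _) rmorph_sum /mixed_volume_sum.
under eq_bigr do rewrite facet_term_t.
rewrite (@sum_facet_terms F n N generic_mx D _ t_vec e0_vec m) //.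
- by apply: eq_bigr => s sD; rewrite facet_term_e0 // (ordered_facets_uniq sD).
- by apply: (rmorph_pchar const_frac); apply: pchar2_frac.
- move=> s sD; rewrite simplex_mx_generic map_unitmx amx_unit //.
  exact: ordered_facets_uniq sD.
- by move=> s q sD; apply/coord_t_neq0/(ordered_facets_uniq sD).
- move=> s q sD; have us := ordered_facets_uniq sD.
  by rewrite coord_e0 // fmorph_eq0 e0_coord_neq0.
by move=> s q r sD; apply/coord_cross_neq/(ordered_facets_uniq sD).
Qed.

End Linking.

(** * The theorem *)

Section Assembly.
Variables (k : fieldType) (n N : nat).
Local Notation K := {fraction {mpoly k[n * N]}}.
Implicit Types I J : n.-tuple 'I_N.

Lemma partial_sum I (T : Type) (r : seq T) (P : pred T) (f : T -> K) :
  partial_ I (\sum_(x <- r | P x) f x) = \sum_(x <- r | P x) partial_ I (f x).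
Proof. by rewrite /partial_; elim: (enum 'I_n) => //= p ps ->; rewrite raddf_sum. Qed.

Lemma mdeg_x_mnm I : mdeg (x_mnm I) = n.
Proof.
rewrite mdeg_sum; under eq_bigr do rewrite mdeg1.
by rewrite sum1_card card_ord.
Qed.

Lemma sqr_monomialE I J (m : 'X_{1..N}) :
  'X_[m] ^+ 2 = x_ K I * x_ K J <-> (x_mnm I + x_mnm J = m + m)%MM.
Proof.
rewrite !x_mnmE expr2 -!mpolyXD; split=> [|-> //].
move=> /(congr1 (mcoeff (x_mnm I + x_mnm J)%MM)); rewrite !mcoeffX eqxx.
by case: eqP => // _ /eqP; rewrite eq_sym oner_eq0.
Qed.

End Assembly.

Theorem theorem4p1 (R : realType) (k : fieldType) (n N : nat)
    (hk : 2%N \in [pchar k]) (D : {set {set 'I_N}})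
    (hD : pseudo_manifold R n D) (I J : n.-tuple 'I_N) :
  let K := {fraction {mpoly k[n * N]}} in
  let W : {mpoly K[N]} -> K := mixed_volume D in
  (forall m : 'X_{1..N}, 'X_[m] ^+ 2 = x_ K I * x_ K J ->
     partial_ I (W (x_ K J)) = W 'X_[m] ^+ 2) /\
  (~ (exists m : 'X_{1..N}, 'X_[m] ^+ 2 = x_ K I * x_ K J) ->
     partial_ I (W (x_ K J)) = 0).
Proof.
move=> K W; have [DC Dp Dr _] := hD.
have WE m : mdeg m = n -> W 'X_[m] = \sum_(s in ordered_facets n D) simplex_term s 'X_[m].
  exact: mixed_volume_monomial.
have dW : partial_ I (W (x_ K J)) =
    \sum_(s in ordered_facets n D) partial_ I (simplex_term s (x_ K J)).
  by rewrite x_mnmE WE ?mdeg_x_mnm // partial_sum.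
split=> [m /sqr_monomialE mE|nsq]; rewrite dW.
  have mn : mdeg m = n.
    have := congr1 (@mdeg N) mE; rewrite !mdegD !mdeg_x_mnm !addnn => /esym.
    exact: double_inj.
  have frob2 := pFrobenius_autE (pchar2_frac n N hk).
  rewrite WE // -frob2 rmorph_sum; apply: eq_bigr => s sD /=; rewrite frob2.
  by apply: partial_simplex_term_square => //; apply: ordered_facets_uniq sD.
rewrite big1 // => s sD; apply: partial_simplex_term_nonsquare => //.
  exact: ordered_facets_uniq sD.
by move=> [m /sqr_monomialE mE]; apply: nsq; exists m.
Qed.
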